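(* Let $V$ be a countably infinite dimensional vector space over a finite field. Let $k\geq1$ be an integer and let $H\leq\mathrm{GL}(V)$ be a subgroup which is linearly $k$-transitive and admits a mixed identity of length $l$. Then at least one of the following holds: (i) $H\cap\mathrm{GL}_{\rm fin}(V)$ is a locally finite, linearly $(\lceil k/2\rceil-1)$-transitive, normal subgroup of $H$; (ii) $k\leq 2l$.
   Context: Linear maps act on vectors from the right; $v.g$ is the image of $v\in V$ under $g$. For $k\in\mathbb{N}$, a group $H\leq\mathrm{GL}(V)$ is linearly $k$-transitive if for all $k$-element sets of linearly independent vectors $\{u_1,\ldots,u_k\}$ and $\{w_1,\ldots,w_k\}$ of $V$ there is $h\in H$ with $u_i.h=w_i$ for all $i\in\{1,\dots,k\}$ (for $k=0$ this is no condition). Let $\mathbb{F}_q$ be the ground field. For $g\in\mathrm{GL}(V)$ put $|g|=\min_{\lambda\in\mathbb{F}_q^\times}\mathrm{rk}(g-\lambda 1_V)\in\mathbb{N}\cup\{\infty\}$, and $\mathrm{GL}_{\rm fin}(V)=\{g\in\mathrm{GL}(V):|g|<\infty\}$, a normal subgroup of $\mathrm{GL}(V)$. A group is locally finite if all its finitely generated subgroups are finite. Mixed identities. $\mathbf{F}_r=\langle x_1,\ldots,x_r\rangle$ is the free group of rank $r$. For $w\in H\ast\mathbf{F}_r$, $w(h_1,\dots,h_r)$ is the image of $w$ under the homomorphism $H\ast\mathbf{F}_r\to H$ that is the identity on $H$ and maps $x_i\mapsto h_i$. Write $w=c_0x_{\iota(1)}^{\varepsilon(1)}c_1\cdots c_{l-1}x_{\iota(l)}^{\varepsilon(l)}c_l$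 with $c_j\in H$, $\iota(j)\in\{1,\dots,r\}$, $\varepsilon(j)\in\{\pm1\}$. This expression is reduced if, for every $j\in\{1,\dots,l-1\}$: when $\iota(j)=\iota(j+1)$ and $\varepsilon(j)=-\varepsilon(j+1)$, the constant $c_j$ does not lie in the centre of $H$; and otherwise $c_j$ is not a non-trivial element of the centre of $H$. A mixed identity of length $l$ for $H$ is a word $w\in H\ast\mathbf{F}_r$ (for some $r\geq1$) which is given by a reduced expression with $l\geq1$ letters $x_{\iota(j)}^{\varepsilon(j)}$ and satisfies $w(h_1,\dots,h_r)=1$ for all $h_1,\dots,h_r\in H$. *)

(* Defs.v *)
From HB Require Import structures.
From mathcomp Require Import all_boot all_order all_algebra.
From mathcomp Require Import boolp classical_sets cardinality constructive_ereal.

Set Implicit Arguments.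
Unset Strict Implicit.
Unset Printing Implicit Defensive.

Import Order.TTheory GRing.Theory.

Local Open Scope classical_set_scope.
Local Open Scope ring_scope.

Section LinearAlgebra.
Variables (F : fieldType) (V : lmodType F).

Definition lin_indep (I : eqType) (b : I -> V) : Prop :=
  forall (s : seq I) (c : I -> F), uniq s ->
    \sum_(i <- s) c i *: b i = 0 -> {in s, forall i, c i = 0}.

Definition lin_span (I : eqType) (b : I -> V) : set V :=
  [set v | exists (s : seq I) (c : I -> F), v = \sum_(i <- s) c i *: b i].

Definition is_basis (I : eqType) (b : I -> V) (W : set V) : Prop :=
  lin_indep b /\ lin_span b = W.

Definition countably_infinite_dim : Prop :=
  exists b : nat -> V, is_basis b setT.

(* +oo is the default value of xget, taken when W has no finite basis. *)
Definition lin_dim (W : set V) : \bar int :=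
  xget +oo%E [set (n%:Z)%:E | n in [set n | exists b : 'I_n -> V, is_basis b W]].

Definition rk (f : V -> V) : \bar int := lin_dim (range f).

End LinearAlgebra.

Record GL (F : fieldType) (V : lmodType F) := MkGL {
  GL_fun :> V -> V;
  GL_linear : linear GL_fun;
  GL_bij : bijective GL_fun }.

Section GLGroup.
Variables (F : fieldType) (V : lmodType F).
Implicit Types g h : GL V.

Lemma GL_ext g h : g =1 h -> g = h.
Proof.
case: g h => [f lf bf] [f' lf' bf'] /= /funext e.
by subst f'; congr MkGL; exact: Prop_irrelevance.
Qed.

HB.instance Definition _ := gen_eqMixin (GL V).
HB.instance Definition _ := gen_choiceMixin (GL V).

HB.instance Definition _ g :=
  GRing.isLinear.Build F V V *:%R (GL_fun g) (GL_linear g).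

Lemma GL_inv_ex g : exists h, cancel g h /\ cancel h g.
Proof.
case: (GL_bij g) => f' gK fK.
have lf : linear f' := can2_linear gK fK.
by exists (MkGL lf (Bijective fK gK)).
Qed.

Definition GL_one : GL V := @MkGL F V id (fun _ _ _ => erefl) (inv_bij (frefl _)).

Definition GL_inv g : GL V := projT1 (cid (GL_inv_ex g)).

Lemma GL_mul_linear g h : linear (h \o g).
Proof. by move=> a u v /=; rewrite !linearP. Qed.

(* Maps act from the right: v.(g * h) = (v.g).h is h (g v). *)
Definition GL_mul g h : GL V :=
  MkGL (GL_mul_linear g h) (bij_comp (GL_bij h) (GL_bij g)).

Lemma GL_mulA : associative GL_mul.
Proof. by move=> f g h; exact: GL_ext. Qed.

Lemma GL_mul1 : left_id GL_one GL_mul.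
Proof. by move=> g; exact: GL_ext. Qed.

Lemma GL_mulr1 : right_id GL_one GL_mul.
Proof. by move=> g; exact: GL_ext. Qed.

Lemma GL_mulV : left_inverse GL_one GL_inv GL_mul.
Proof.
by move=> g; apply: GL_ext => v /=; rewrite /GL_inv; case: cid => h [] /=.
Qed.

Lemma GL_mulrV : right_inverse GL_one GL_inv GL_mul.
Proof.
by move=> g; apply: GL_ext => v /=; rewrite /GL_inv; case: cid => h [] /=.
Qed.

HB.instance Definition _ :=
  isGroup.Build (GL V) GL_mulA GL_mul1 GL_mulr1 GL_mulV GL_mulrV.

End GLGroup.

Section Groups.
Local Open Scope group_scope.
Variable G : groupType.
Implicit Types H N : set G.

Definition subgroup H : Prop := group_closed [in H].

Definition normal_subgroup N H : Prop :=
  [/\ subgroup N, N `<=` H & forall n h, N n -> H h -> N (n ^ h)].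

Definition center H : set G := [set z | H z /\ forall h, H h -> commute z h].

Definition locally_finite H : Prop :=
  forall S : set G, finite_set S -> S `<=` H -> finite_set (smallest subgroup S).

(* The expression c_0 x_(var 0)^(sgn 0) c_1 ... x_(var (l-1))^(sgn (l-1)) c_l;
   letters are numbered from 0, so c_(j+1), i.e. cst (lift ord0 j), stands to the
   right of letter j, and sgn j = true stands for the exponent 1, sgn j = false for -1. *)
Record expression (r l : nat) := Expression {
  cst : 'I_l.+1 -> G;
  var : 'I_l -> 'I_r;
  sgn : 'I_l -> bool }.

(* The value at x of the word in G * F_r denoted by the expression. *)
Definition eval r l (w : expression r l) (x : 'I_r -> G) : G :=
  cst w ord0 *
  \prod_(j < l) ((if sgn w j then x (var w j) else (x (var w j))^-1) *
                 cst w (lift ord0 j)).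

Definition reduced H r l (w : expression r l) : Prop :=
  forall j j' : 'I_l, j' = j.+1 :> nat ->
    let c := cst w (lift ord0 j) in
    if (var w j == var w j') && (sgn w j != sgn w j')
    then ~ center H c
    else ~ (center H c /\ c <> 1).

Definition has_mixed_identity H (l : nat) : Prop :=
  (1 <= l)%N /\
  exists r : nat, (1 <= r)%N /\
    exists w : expression r l,
      [/\ forall j, H (cst w j),
          reduced H w &
          forall h : 'I_r -> G, (forall i, H (h i)) -> eval w h = 1].

End Groups.

Definition linearly_transitive (F : fieldType) (V : lmodType F)
    (k : nat) (H : set (GL V)) : Prop :=
  forall u w : 'I_k -> V, lin_indep u -> lin_indep w ->
    exists2 h, H h & forall i, h (u i) = w i.

Definition proj_rk (F : finFieldType) (V : lmodType F) (g : GL V) : \bar int :=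
  \big[Order.min/+oo%E]_(lambda : F | lambda != 0)
    rk (fun v => g v - lambda *: v).

Definition GLfin (F : finFieldType) (V : lmodType F) : set (GL V) :=
  [set g | (proj_rk g < +oo)%E].
Arguments GLfin {F} V.

(* Main.v *)
(* Over a finite field a subspace is finite-dimensional iff it is a finite set, so
   [GLfin V] consists of the maps [g] for which some [g - a], [a != 0], has finite range.

   If every element of [H] in [GLfin V] is scalar, a mixed identity is refuted by
   prescribing the values of the variables letter by letter along the trajectory of a
   vector: modulo any finite-dimensional subspace, a constant outside [GLfin V] sends some
   vector off its own line, so each prescribed vector can be kept independent of the
   earlier ones. Hence [H] contains a non-scalar [g] in [GLfin V].

   Multiplying such a [g] by suitable conjugates increases the number [n] of vectors for
   which [v_1, .., v_n, v_1.g, .., v_n.g] are independent; conjugating the result sends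
   any independent family to any other one that is independent of it.

   Finitely many elements of [GLfin V] generate a finite group: all its elements are
   scalar on a common subspace of finite index and are scalar on [V] modulo a common
   finite subspace. *)
Require Import Defs.
From mathcomp Require Import all_boot all_order all_algebra.
From mathcomp Require Import boolp classical_sets cardinality constructive_ereal.
From mathcomp Require Import zify.

Set Implicit Arguments.
Unset Strict Implicit.
Unset Printing Implicit Defensive.

Import Order.TTheory GRing.Theory.

Local Open Scope classical_set_scope.

Lemma codom_nth (T : Type) (x0 : T) n (s : seq T) :
  size s = n -> codom (fun i : 'I_n => nth x0 s i) = s.
Proof.
move=> <-; rewrite codomE (map_comp (nth x0 s)) val_enum_ord map_nth_iota0 //.
by rewrite take_size.
Qed.

(** * Spans and free families of finite lists of vectors *)

Section Span.
Local Open Scope ring_scope.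
Variables (F : fieldType) (V : lmodType F).
Implicit Types (s t : seq V) (u v w : V).

(** Recursion on the list lets finiteness and independence be treated one vector at a time. *)
Fixpoint span s : set V :=
  if s is v :: s' then [set x | exists a : F, span s' (x - a *: v)] else [set 0].

Definition free s : Prop :=
  uniq s /\ forall c : V -> F,
    \sum_(v <- s) c v *: v = 0 -> {in s, forall v, c v = 0}.

Lemma span0 s : span s 0.
Proof. by elim: s => [|v s IH] //=; exists 0; rewrite scale0r subr0. Qed.

Lemma spanP s a u v : span s u -> span s v -> span s (a *: u + v).
Proof.
elim: s u v => [|x s IH] u v /=; first by move=> -> ->; rewrite scaler0 addr0.
move=> [b ub] [c vc]; exists (a * b + c).
rewrite scalerDl -scalerA opprD addrACA -scalerBr; exact: IH.
Qed.

Lemma spanZ s a u : span s u -> span s (a *: u).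
Proof. by move=> su; rewrite -[_ *: _]addr0; apply: spanP => //; exact: span0. Qed.

Lemma spanD s u v : span s u -> span s v -> span s (u + v).
Proof. by move=> su sv; rewrite -[u]scale1r; exact: spanP. Qed.

Lemma spanB s u v : span s u -> span s v -> span s (u - v).
Proof. by move=> su sv; rewrite -scaleN1r addrC; exact: spanP. Qed.

Lemma spanZE s a u : a != 0 -> span s (a *: u) -> span s u.
Proof. by move=> a0 /(spanZ a^-1); rewrite scalerA mulVf // scale1r. Qed.

Lemma span_cons s x : span s `<=` span (x :: s).
Proof. by move=> v sv /=; exists 0; rewrite scale0r subr0. Qed.

Lemma mem_span s v : v \in s -> span s v.
Proof.
elim: s => [//|x s IH]; rewrite in_cons => /orP[/eqP -> /=|/IH]; last exact: span_cons.
by exists 1; rewrite scale1r subrr; exact: span0.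
Qed.

Lemma span_min s (W : set V) : W 0 ->
  (forall a u v, W u -> W v -> W (a *: u + v)) -> (forall v, v \in s -> W v) ->
  span s `<=` W.
Proof.
move=> W0 WP; elim: s => [|x s IH] sW v /=; first by move=> ->.
move=> [a /IH va]; rewrite -(subrK (a *: x) v) addrC; apply: WP.
  by apply: sW; rewrite mem_head.
by apply: va => y ys; apply: sW; rewrite in_cons ys orbT.
Qed.

Lemma span_sum (I : Type) (r : seq I) (P : pred I) (f : I -> V) s :
  (forall i, P i -> span s (f i)) -> span s (\sum_(i <- r | P i) f i).
Proof. by move=> h; apply: big_ind => //; [exact: span0|exact: spanD]. Qed.

Lemma span_sumP s v : uniq s -> span s v -> exists c : V -> F, v = \sum_(x <- s) c x *: x.
Proof.
elim: s v => [|x s IH] v; first by move=> _ /= ->; exists (fun=> 0); rewrite big_nil.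
move=> /= /andP[xs /IH us] [a /us[c ec]].
exists (fun y => if y == x then a else c y); rewrite big_cons eqxx.
rewrite -[LHS](subrK (a *: x)) ec addrC; congr (_ + _).
by apply: eq_big_seq => y ys; case: eqP ys xs => // -> ->.
Qed.

Lemma free_cons v s : free (v :: s) <-> ~ span s v /\ free s.
Proof.
split=> [[/= /andP[vs us] fs]|[vs [us fs]]].
  split; last first.
    split=> // c ec x xs.
    have := fs (fun y => if y == v then 0 else c y).
    rewrite big_cons eqxx scale0r add0r => /(_ _)/(_ x); rewrite in_cons xs orbT.
    have -> : (x == v) = false by apply: contraNF vs => /eqP <-.
    apply=> //; rewrite -[RHS]ec; apply: eq_big_seq => y ys.
    by case: eqP ys vs => // -> ->.
  move=> /(span_sumP us)[c ec].
  have := fs (fun y => if y == v then -1 else c y).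
  rewrite big_cons eqxx scaleN1r => /(_ _)/(_ v); rewrite mem_head eqxx.
  have -> : \sum_(j <- s) (if j == v then -1 else c j) *: j = v.
    by rewrite [RHS]ec; apply: eq_big_seq => y ys; case: eqP ys vs => // -> ->.
  by rewrite addNr => /(_ erefl erefl)/eqP; rewrite oppr_eq0 oner_eq0.
split=> [/=|c]; first by rewrite us andbT; apply/negP => /mem_span.
rewrite big_cons => ec.
have cv : c v = 0.
  apply/eqP/negPn/negP => cv; apply: vs; apply: (spanZE cv).
  move/eqP: ec; rewrite addr_eq0 => /eqP ->; rewrite -scaleN1r; apply: spanZ.
  by rewrite big_seq; apply: span_sum => x /mem_span sx; exact: spanZ.
move=> x; rewrite in_cons => /orP[/eqP -> //|]; apply: fs.
by rewrite -[RHS]ec cv scale0r add0r.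
Qed.

Lemma free_nil : free [::].
Proof. by split. Qed.

Lemma free_perm s t : perm_eq s t -> free s -> free t.
Proof.
move=> st [us fs]; split; first by rewrite -(perm_uniq st).
by move=> c; rewrite -(perm_big _ st) /= => /fs cs v; rewrite -(perm_mem st); exact: cs.
Qed.

Lemma free_catr s t : free (s ++ t) -> free t.
Proof. by elim: s => //= x s IH /free_cons[]. Qed.

Lemma free_subperm t' s t : perm_eq (t' ++ s) t -> free t -> free s.
Proof. by move=> p ft; apply: (@free_catr t'); apply: free_perm ft; rewrite perm_sym. Qed.

Lemma free_scale_head a v s : a != 0 -> free (v :: s) -> free (a *: v :: s).
Proof.
move=> a0 /free_cons[vs fs]; apply/free_cons; split=> //.
by move/(spanZE a0).
Qed.

Lemma lin_indep_inj (I : eqType) (b : I -> V) : lin_indep b -> injective b.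
Proof.
move=> ib i j eb; apply/eqP/negPn/negP => ij.
have := ib [:: i; j] (fun x => if x == i then 1 else -1).
rewrite /= inE ij => /(_ erefl).
rewrite big_cons big_seq1 eqxx eq_sym (negbTE ij) eb scaleN1r scale1r subrr.
move=> /(_ erefl i); rewrite mem_head eqxx => /(_ erefl)/eqP.
by rewrite oner_eq0.
Qed.

Lemma free_lin_indep n (b : 'I_n -> V) : free (codom b) <-> lin_indep b.
Proof.
split=> [[ub fb] s c us|ib].
  have binj : injective b by apply/injectiveP.
  move=> ec i is_.
  (* [free] indexes coefficients by vectors: [v] gets the sum of [c] over its fibre, which has at
     most one term because [b] is injective. *)
  have := fb (fun v => \sum_(j <- s | b j == v) c j).
  have cE j : \sum_(j0 <- s | b j0 == b j) c j0 = if j \in s then c j else 0.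
    rewrite (eq_bigl (pred1 j)); last by move=> x /=; rewrite (inj_eq binj).
    case: ifP => js; first by rewrite -big_filter filter_pred1_uniq // big_seq1.
    by rewrite big1_seq // => x /andP[/eqP -> ]; rewrite js.
  rewrite codomE big_map => /(_ _)/(_ (b i)).
  rewrite cE is_; apply; last exact: map_f (mem_enum _ _).
  rewrite -[RHS]ec [RHS]big_uniq //= big_enum [RHS]big_mkcond /=.
  by apply: eq_bigr => j _; rewrite cE; case: ifP => // _; rewrite scale0r.
split; first exact/injectiveP/lin_indep_inj.
move=> c; rewrite codomE big_map => ec v /mapP[i ie ->].
exact: (ib (enum 'I_n) (c \o b) (enum_uniq _) ec i).
Qed.

End Span.

(** * Finite subspaces and a criterion for [GLfin] *)

Section FiniteRank.
Local Open Scope ring_scope.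
Variables (F : finFieldType) (V : lmodType F).
Implicit Types (s t : seq V) (u v w : V) (g : GL V).

Lemma finite_span s : finite_set (span s).
Proof.
elim: s => [|x s IH] /=; first exact: finite_set1.
have fT : finite_set [set: F] by exact: finite_finset.
apply: sub_finite_set (finite_image2 (fun (a : F) y => y + a *: x) fT IH).
by move=> v [a va]; exists a => //; exists (v - a *: x) => //; rewrite subrK.
Qed.

Lemma exists_free_span s : exists2 t, {subset t <= s} & free t /\ span t = span s.
Proof.
elim: s => [|x s [t ts [ft st]]]; first by exists [::] => //; split => //; exact: free_nil.
have [xt|xt] := pselect (span t x).
  exists t; first by move=> y /ts ys; rewrite in_cons ys orbT.
  split=> //; apply/seteqP; split; first by rewrite st; exact: span_cons.
  apply: span_min; [exact: span0|by move=> *; exact: spanP|].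
  by move=> v; rewrite in_cons => /orP[/eqP -> //|/mem_span]; rewrite st.
exists (x :: t).
  by move=> y; rewrite !in_cons => /orP[-> //|/ts ->]; rewrite orbT.
by split; [exact/free_cons|rewrite /= st].
Qed.

(** Over a finite field a finite list has a finite span; conversely, a finite subspace is spanned by
    the list of its elements, from which a basis is extracted. *)
Lemma lin_dim_fin (W : set V) : W 0 ->
  (forall a u v, W u -> W v -> W (a *: u + v)) ->
  (lin_dim W < +oo)%E <-> finite_set W.
Proof.
move=> W0 WP; split.
  rewrite /lin_dim; case: xgetP => [x _ [n [b [_ <-]] _] _|_]; last by rewrite ltxx.
  apply: sub_finite_set (finite_span (codom b)) => v [s [c ->]].
  by apply: span_sum => i _; apply: spanZ; apply: mem_span; exact: codom_f.
move=> /finite_seqP[s Ws].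
have [t ts [ft st]] := exists_free_span s.
have tW : span t = W.
  rewrite st; apply/seteqP; split; last by move=> v; rewrite Ws => /mem_span.
  by apply: span_min => // v vs; rewrite Ws.
have tE := codom_nth 0 (erefl (size t)).
suff : [set (n%:Z)%:E | n in [set n | exists b : 'I_n -> V, is_basis b W]] (lin_dim W).
  by case=> n _ <-; exact: ltry.
apply: xgetPex; exists (size t)%:Z%:E; exists (size t) => //.
exists (fun i => t`_i); split; first by apply/free_lin_indep; rewrite tE.
apply/seteqP; split=> [v [r [c ->]]|v].
  apply: (big_ind W) => // [x y Wx Wy|i _]; first by rewrite -[x]scale1r; exact: WP.
  by rewrite -tW; apply: spanZ; apply: mem_span; exact: mem_nth.
rewrite -tW => /(span_sumP ft.1)[c ->].
exists (enum 'I_(size t)), (fun i : 'I_(size t) => c t`_i).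
by rewrite -{1}tE codomE big_map.
Qed.

Lemma shift_linear g a : linear (fun v => g v - a *: v).
Proof.
move=> b u v; rewrite linearP scalerDr scalerBr opprD addrACA.
by rewrite !scalerA mulrC.
Qed.

Lemma range_linear (f : V -> V) : linear f ->
  range f 0 /\ forall a u v, range f u -> range f v -> range f (a *: u + v).
Proof.
move=> lf; split.
  by exists 0 => //; have := lf (-1) 0 0; rewrite !scaleN1r oppr0 addr0 addNr.
by move=> a _ _ [u _ <-] [v _ <-]; exists (a *: u + v); rewrite ?lf.
Qed.

Lemma GLfinP g :
  GLfin V g <-> exists2 a : F, a != 0 & finite_set (range (fun v => g v - a *: v)).
Proof.
have rkE a : (rk (fun v => g v - a *: v)%R < +oo)%E <->
    finite_set (range (fun v => g v - a *: v)).
  by have [? ?] := range_linear (shift_linear g a); exact: lin_dim_fin.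
rewrite /GLfin /proj_rk /=; split=> [|[a a0 /rkE]].
  apply: contraPP => nex; apply/negP; rewrite -leNgt.
  apply: le_bigmin => // a a0; rewrite leNgt; apply/negP => /rkE fa.
  by apply: nex; exists a.
by move=> lt; apply: le_lt_trans lt; exact: bigmin_le_cond.
Qed.

End FiniteRank.

(** * Automorphisms as maps, and those that are scalar modulo a finite subspace *)

Section GLAction.
Local Open Scope ring_scope.
Variables (F : fieldType) (V : lmodType F).
Implicit Types (g h : GL V) (v : V).

Lemma GL_mulE g h v : (g * h)%g v = h (g v).
Proof. by []. Qed.

Lemma GLK g : cancel g (g^-1)%g.
Proof. by move=> v; rewrite -GL_mulE mulgV. Qed.

Lemma GLVK g : cancel (g^-1)%g g.
Proof. by move=> v; rewrite -GL_mulE mulVg. Qed.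

Lemma GL_inj g : injective g.
Proof. exact: can_inj (GLK g). Qed.

Lemma GLZ g a v : g (a *: v) = a *: g v.
Proof. exact: linearZ. Qed.

End GLAction.

Section InfiniteDim.
Local Open Scope ring_scope.
Variables (F : finFieldType) (V : lmodType F).
Implicit Types (s t : seq V) (u v w : V) (g : GL V).
Hypothesis infV : infinite_set [set: V].

Lemma exists_notin (A : set V) : finite_set A -> exists v, ~ A v.
Proof.
move=> fA; apply: contrapT => nA; apply: infV; apply: sub_finite_set fA => v _.
by apply: contrapT => Av; apply: nA; exists v.
Qed.

(** Two vectors independent modulo [span s] have the same eigenvalue there, as their sum shows; a
    third vector links any two outside [span s]. *)
Lemma scalar_mod s g :
  (forall v, ~ span s v -> span (v :: s) (g v)) ->
  exists2 a : F, a != 0 & forall v, span s (g v - a *: v).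
Proof.
move=> h.
have shiftD x y c : g (x + y) - c *: (x + y) = (g x - c *: x) + (g y - c *: y).
  by rewrite linearD scalerDr opprD addrACA.
have shiftB x c d : (g x - c *: x) - (g x - d *: x) = (d - c) *: x.
  by rewrite opprB addrC addrA subrK scalerBl.
have link u w a b : ~ span s u -> ~ span (u :: s) w ->
    span s (g u - a *: u) -> span s (g w - b *: w) -> a = b.
  move=> nu nw ga gb.
  have nuw : ~ span s (u + w).
    by move=> suw; apply: nw; exists (-1); rewrite scaleN1r opprK addrC.
  have [c gc] := h _ nuw.
  have e : span s ((a - c) *: u + (b - c) *: w).
    have -> : (a - c) *: u + (b - c) *: w =
        (g (u + w) - c *: (u + w)) - ((g u - a *: u) + (g w - b *: w)).
      by rewrite shiftD opprD addrACA !shiftB.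
    exact: (spanB gc (spanD ga gb)).
  have bc : b - c = 0.
    apply/eqP/negPn/negP => bc; apply: nw; apply: (spanZE bc).
    by exists (c - a); rewrite -[c - a]opprB scaleNr opprK addrC.
  have ac : a - c = 0.
    apply/eqP/negPn/negP => ac; apply: nu; apply: (spanZE ac).
    by move: e; rewrite bc scale0r addr0.
  by rewrite (subr0_eq ac) (subr0_eq bc).
have [u nu] := exists_notin (finite_span s).
have [a ga] := h _ nu.
have gaN v : ~ span s v -> span s (g v - a *: v).
  move=> nv; have [b gb] := h _ nv.
  have fU : finite_set (span (u :: s) `|` span (v :: s)).
    by rewrite finite_setU; split; exact: finite_span.
  have [w /not_orP[nuw nvw]] := exists_notin fU.
  have [c gc] := h w (contra_not (@span_cons _ _ _ _ _) nuw).
  by rewrite (link u w a c) // -(link v w b c).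
have gaV v : span s (g v - a *: v).
  have [sv|] := pselect (span s v); last exact: gaN.
  (* A vector of [span s] is the difference of [v + u] and [u], both outside it. *)
  have nvu : ~ span s (v + u).
    by move=> svu; apply: nu; rewrite -(addKr v u) addrC; exact: spanB.
  have -> : g v - a *: v = (g (v + u) - a *: (v + u)) - (g u - a *: u).
    by rewrite shiftD addrK.
  by apply: spanB; exact: gaN.
(* With [a = 0] the surjective [g] would map the infinite [V] into the finite [span s]. *)
exists a => //; apply/eqP => a0; apply: infV.
apply: sub_finite_set (finite_span s) => v _.
by have := gaV (g^-1 v)%g; rewrite a0 scale0r subr0 GLVK.
Qed.

End InfiniteDim.

(** * Closure properties of [GLfin] and finiteness of sets of values *)

Lemma subgroupP (G : groupType) (H : set G) :
  subgroup H <-> [/\ H 1%g, forall x y, H x -> H y -> H (x * y)%g &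
                            forall x, H x -> H (x^-1)%g].
Proof.
have mE x : (x \in [in H]) = (x \in H) by [].
split=> [sH|[H1 HM HV]].
  have [H1 _] := sH.
  split=> [|x y|x]; rewrite -!(in_setE H) //.
    by move=> Hx Hy; apply: (group_closedM sH).
  exact: (group_closedV sH).
split; first by rewrite mE inE.
by move=> x y; rewrite !mE !inE => Hx Hy; apply: HM => //; exact: HV.
Qed.

Section FinitaryGroup.
Local Open Scope ring_scope.
Variables (F : finFieldType) (V : lmodType F).
Implicit Types (s t : seq V) (u v w : V) (g h : GL V).

Lemma GLfin1 : GLfin V (1 : GL V)%g.
Proof.
apply/GLfinP; exists 1; first exact: oner_neq0.
by apply: sub_finite_set (finite_set1 0) => _ [v _ <-]; rewrite /= scale1r subrr.
Qed.

Lemma GLfinM g h : GLfin V g -> GLfin V h -> GLfin V (g * h)%g.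
Proof.
move=> /GLfinP[a a0 fa] /GLfinP[b b0 fb].
apply/GLfinP; exists (a * b); first by rewrite mulf_neq0.
(* The product splits as [h (g v) - (a * b) *: v = (h (g v) - b *: g v) + b *: (g v - a *: v)]. *)
apply: sub_finite_set (finite_image2 (fun x y => y + b *: x) fa fb) => _ [v _ <-].
exists (g v - a *: v); first by exists v.
exists (h (g v) - b *: g v); first by exists (g v).
by rewrite scalerBr scalerA [b * a]mulrC addrA subrK.
Qed.

Lemma GLfinV g : GLfin V g -> GLfin V g^-1%g.
Proof.
move=> /GLfinP[a a0 fa]; apply/GLfinP; exists a^-1; first by rewrite invr_eq0.
apply: sub_finite_set (finite_image (fun x => - a^-1 *: x) fa) => _ [v _ <-].
exists (g (g^-1 v)%g - a *: (g^-1 v)%g); first by exists (g^-1 v)%g.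
by rewrite GLVK scaleNr scalerBr opprB scalerA mulVf // scale1r.
Qed.

Lemma GLfinJ g h : GLfin V g -> GLfin V (g ^ h)%g.
Proof.
move=> /GLfinP[a a0 fa]; apply/GLfinP; exists a => //.
apply: sub_finite_set (finite_image h fa) => _ [v _ <-].
exists (g (h^-1 v)%g - a *: (h^-1 v)%g); first by exists (h^-1 v)%g.
by rewrite linearB linearZ /= GLVK.
Qed.

Lemma GLfin_normal (H : set (GL V)) :
  subgroup H -> normal_subgroup (H `&` GLfin V) H.
Proof.
move=> sH; have [H1 HM HV] := (subgroupP H).1 sH; split.
- apply/subgroupP; split=> [|g h [Hg fg] [Hh fh]|g [Hg fg]].
  + by split; [|exact: GLfin1].
  + by split; [exact: HM|exact: GLfinM].
  + by split; [exact: HV|exact: GLfinV].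
- by move=> g [].
- move=> g h [Hg fg] Hh; split; last exact: GLfinJ.
  exact: (HM _ _ (HV _ Hh) (HM _ _ Hg Hh)).
Qed.

Lemma finite_maps (A : eqType) (B : Type) (X : seq A) (R : set B) :
  finite_set R ->
  finite_set [set map f X | f in [set f : A -> B | forall x, x \in X -> R (f x)]].
Proof.
move=> fR; elim: X => [|x X IH] /=.
  by apply: sub_finite_set (finite_set1 [::]) => _ [f _ <-].
apply: sub_finite_set (finite_image2 cons fR IH) => _ [f fX <-].
exists (f x); first by apply: fX; rewrite mem_head.
by exists [seq f y | y <- X] => //; exists f => // y yX; apply: fX; rewrite in_cons yX orbT.
Qed.

(** [X] meets every fibre of [f]; for additive [f] it represents all cosets of the kernel. *)
Lemma finite_section (A : eqType) (B : Type) (f : A -> B) :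
  finite_set (range f) -> exists X : seq A, forall y, exists2 x, x \in X & f y = f x.
Proof.
move=> fr; have [[x0 _]|nA] := pselect (exists x : A, True); last first.
  by exists [::] => v; exfalso; apply: nA; exists v.
have rep (y : B) : exists x, range f y -> f x = y.
  by have [[x _ <-]|ny] := pselect (range f y); [exists x|exists x0 => /ny].
have [r fr'] := choice rep.
have /finite_seqP[X XE] := finite_image r fr.
exists X => v; exists (r (f v)); last by rewrite fr' //; exists v.
by have : [set` X] (r (f v)) by rewrite -XE; exists (f v) => //; exists v.
Qed.

End FinitaryGroup.

(** * Local finiteness, and eigenspaces of finite index *)

Section LocallyFinite.
Local Open Scope ring_scope.
Variables (F : finFieldType) (V : lmodType F).
Implicit Types (s t : seq V) (u v w : V) (g h : GL V).

Definition near_scalar (U : set V) s : set (GL V) :=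
  [set g | exists a : F, [/\ a != 0, forall v, span s (g v - a *: v) &
                           forall u, U u -> g u = a *: u]].

Lemma near_scalar_subgroup (U : set V) s : subgroup (near_scalar U s).
Proof.
apply/subgroupP; split.
- exists 1; split=> [|v|u _]; rewrite ?oner_neq0 //= scale1r // subrr; exact: span0.
- move=> g h [a [a0 ga gU]] [b [b0 hb hU]]; exists (a * b); split.
  + by rewrite mulf_neq0.
  + move=> v; rewrite /= -(subrK (b *: g v) (h (g v))) -addrA; apply: spanD; first exact: hb.
    by rewrite mulrC -scalerA -scalerBr; apply: spanZ.
  + by move=> u Uu /=; rewrite gU // linearZ /= hU // scalerA.
- move=> g [a [a0 ga gU]]; exists a^-1; split.
  + by rewrite invr_eq0.
  + move=> v; have := spanZ (- a^-1) (ga (g^-1 v)%g).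
    by rewrite GLVK scaleNr scalerBr opprB scalerA mulVf // scale1r.
  + move=> u Uu; apply: (@GL_inj _ _ g).
    by rewrite GLVK linearZ /= gU // scalerA mulVf // scale1r.
Qed.

(** Once the scalar [a] is fixed, [g] is determined by the values [g v - a *: v] for [v] in [X],
    which lie in the finite set [span s]. *)
Lemma near_scalar_finite (U : set V) s (X : seq V) :
  (forall v, exists2 x, x \in X & U (v - x)) -> finite_set (near_scalar U s).
Proof.
move=> UX; pose T (a : F) := [set g : GL V | (forall v, span s (g v - a *: v)) /\
                                   forall u, U u -> g u = a *: u].
apply: (@sub_finite_set _ _ (\bigcup_(a in [set: F]) T a)).
  by move=> g [a [_ ga gU]]; exists a.
apply: bigcup_finite; first exact: finite_finset.
move=> a _.
pose code (g : GL V) := [seq g v - a *: v | v <- X].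
have codeI g h : T a g -> T a h -> code g = code h -> g = h.
  move=> [_ gU] [_ hU] /eq_in_map e; apply: GL_ext => v.
  have [x xX Ux] := UX v.
  rewrite -(subrK x v) (linearD g (v - x)) (linearD h (v - x)) /= gU // hU //; congr (_ + _).
  exact: (addIr _ (e x xX)).
have fR := finite_maps X (finite_span s).
(* [r] decodes a list of values; a list that is no code goes to the default [1]. *)
pose r (c : seq V) : GL V := xget 1%g [set g | T a g /\ code g = c].
apply: sub_finite_set (finite_image r fR) => g Tg.
exists (code g).
  by exists (fun v => g v - a *: v) => // v _; case: Tg.
have : [set h | T a h /\ code h = code g] (r (code g)) by apply: xgetPex; exists g.
by case=> Th; exact: codeI.
Qed.

Lemma GLfin_locally_finite (A : set (GL V)) : A `<=` GLfin V -> locally_finite A.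
Proof.
move=> AG S /finite_seqP[L SL] SA.
have lamP g : exists a : F, g \in L ->
    a != 0 /\ finite_set (range (fun v => g v - a *: v)).
  have [gL|gL] := boolP (g \in L); last by exists 0.
  have /AG/GLfinP[a a0 fa] : A g by apply: SA; rewrite SL.
  by exists a.
have [lam lamL] := choice lamP.
have [R RL] : exists R : seq V, forall g, g \in L -> forall v, g v - lam g *: v \in R.
  have : {subset L <= L} by [].
  elim: {1 3}L => [|g L' IH] sL; first by exists [::].
  have [|R RL] := IH; first by move=> h hL; apply: sL; rewrite in_cons hL orbT.
  have [_ /finite_seqP[Rg RgE]] := lamL _ (sL _ (mem_head _ _)).
  exists (Rg ++ R) => h; rewrite in_cons => hL v; rewrite mem_cat.
  case/orP: hL => [/eqP ->|/RL -> ]; last by rewrite orbT.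
  apply/orP; left; have : [set` Rg] (g v - lam g *: v) by rewrite -RgE; exists v.
  by [].
(* Vectors with the same list [f v] differ by an element of [U], so [U] has finite index. *)
pose U := [set u | forall g, g \in L -> g u = lam g *: u].
pose f v := [seq g v - lam g *: v | g <- L].
have /finite_section[X fX] : finite_set (range f).
  apply: sub_finite_set (finite_maps L (finite_seq R)) => _ [v _ <-].
  by exists (fun g : GL V => g v - lam g *: v) => // g gL; exact: RL.
apply: sub_finite_set (@near_scalar_finite U R X _); last first.
  move=> v; have [x xX /eq_in_map e] := fX v; exists x => // g /e ex.
  apply/eqP; rewrite -subr_eq0 linearB scalerBr /= opprB addrACA [- _ + _]addrC.
  by rewrite addrACA -[X in _ + X]opprB ex subrr.
apply: smallest_sub; first exact: near_scalar_subgroup.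
rewrite SL => g gL; exists (lam g); split; first by case: (lamL g gL).
  by move=> v; apply: mem_span; exact: RL.
by move=> u; apply.
Qed.

(** Vectors with equal [g v - a *: v] differ by a vector that [g] multiplies by [a]. Were all such
    vectors in [span s], then [V] would be the sum of the finite sets [X] and [span s]. *)
Lemma exists_eigenvector g : infinite_set [set: V] -> GLfin V g ->
  exists2 a : F, a != 0 & forall s, exists2 v, ~ span s v & g v = a *: v.
Proof.
move=> infV /GLfinP[a a0 /finite_section[X fX]]; exists a => // s.
apply: contrapT => nv; apply: infV.
apply: sub_finite_set (finite_image2 +%R (finite_seq X) (finite_span s)) => v _.
have [x xX e] := fX v; exists x => //; exists (v - x); last by rewrite addrC subrK.
apply: contrapT => nvx; apply: nv; exists (v - x) => //.
apply/eqP; rewrite -subr_eq0 linearB scalerBr /= opprB addrACA [- _ + _]addrC.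
by rewrite addrACA -[X in _ + X]opprB e subrr.
Qed.

End LocallyFinite.

(** * Linear transitivity of the finitary part of [H] *)

Section Transitivity.
Local Open Scope ring_scope.
Variables (F : finFieldType) (V : lmodType F).
Implicit Types (s t : seq V) (u v w : V) (g h : GL V) (H : set (GL V)).
Hypothesis infV : infinite_set [set: V].

Lemma free_extend s t n : free s -> free t ->
  exists r, [/\ size r = n, free (r ++ s) & free (r ++ t)].
Proof.
move=> fs ft; elim: n => [|n [r [sr frs frt]]]; first by exists [::].
have fU : finite_set (span (r ++ s) `|` span (r ++ t)).
  by rewrite finite_setU; split; exact: finite_span.
have [x /not_orP[xs xt]] := exists_notin infV fU.
by exists (x :: r); split; rewrite /= ?sr //; exact/free_cons.
Qed.

(** The same list [r] completes both families to [k] independent vectors. *)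
Lemma linearly_transitive_seq k H (zs : seq (V * V)) :
  linearly_transitive k H -> free (unzip1 zs) -> free (unzip2 zs) ->
  (size zs <= k)%N -> exists2 h, H h & forall z, z \in zs -> h z.1 = z.2.
Proof.
move=> Hk f1 f2 szk.
have [r [sr fr1 fr2]] := free_extend (k - size zs) f1 f2.
have indep t : size t = k -> free t -> lin_indep (fun i : 'I_k => t`_i).
  by move=> st ft; apply/free_lin_indep; rewrite codom_nth.
have sz1 : size (r ++ unzip1 zs) = k by rewrite size_cat size_map sr subnK.
have sz2 : size (r ++ unzip2 zs) = k by rewrite size_cat size_map sr subnK.
have [h Hh hE] := Hk _ _ (indep _ sz1 fr1) (indep _ sz2 fr2).
exists h => // z /(nthP (0, 0))[j jz <-].
have ik : (size r + j < k)%N by rewrite -sz1 size_cat size_map ltn_add2l.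
have := hE (Ordinal ik); rewrite /= !nth_cat ltnNge leq_addr /= addKn.
by rewrite !(nth_map (0, 0)).
Qed.

Lemma map_zip (A B : eqType) (f : A -> B) (s : seq A) (t : seq B) :
  size s = size t -> (forall z, z \in zip s t -> f z.1 = z.2) -> map f s = t.
Proof.
move=> st fz; rewrite -[RHS](unzip2_zip (s := s)) ?st // -{1}(unzip1_zip (s := s) (t := t)) ?st //.
by rewrite -map_comp; apply/eq_in_map.
Qed.

Definition displaces g s : Prop := free (s ++ map g s).

(* With [vs = x :: vs'], pick eigenvectors [p], [q] of [g] and fresh vectors [b :: bs],
   and conjugate [g] by a map sending [x, g x, p, vs', g vs'] to [q, b, g x, g vs', bs].
   The product of [g] and its conjugate then sends [q, x, vs'] to [b, g x, bs] up to
   scalars. *)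
Lemma displaces_grow k H g s :
  subgroup H -> linearly_transitive k H -> (0 < size s)%N -> ((size s).*2 < k)%N ->
  (H `&` GLfin V) g -> displaces g s ->
  exists2 g', (H `&` GLfin V) g' & exists2 s', size s' = (size s).+1 & displaces g' s'.
Proof.
case: s => [//|x vs] sH Hk _ szk [Hg fg] fv.
have [a a0 ev] := exists_eigenvector infV fg.
have [p /[swap] gp pN] := ev ((x :: vs) ++ map g (x :: vs)).
have [q /[swap] gq qN] := ev ((x :: vs) ++ map g (x :: vs)).
have fp : free (p :: (x :: vs) ++ map g (x :: vs)) by exact/free_cons.
have fq : free (q :: (x :: vs) ++ map g (x :: vs)) by exact/free_cons.
have [[|b bs] [//=[sb] fb _]] := free_extend (size vs).+1 fq fq.
pose zs := [:: (x, q), (g x, b), (p, g x) & zip vs (map g vs) ++ zip (map g vs) bs].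
(* [zs] has [2 * size s + 1] pairs; this uses the strict bound on [size s]. *)
have [h Hh hE] : exists2 h, H h & forall z, z \in zs -> h z.1 = z.2.
  apply: (linearly_transitive_seq Hk).
  - rewrite /unzip1 /= map_cat -/(unzip1 _) -/(unzip1 _) !unzip1_zip ?size_map ?sb //.
    by apply: free_perm fp; apply/permP => P; rewrite /= !count_cat /=; lia.
  - rewrite /unzip2 /= map_cat -/(unzip2 _) -/(unzip2 _) !unzip2_zip ?size_map ?sb //.
    apply: (@free_subperm _ _ (x :: vs)) fb.
    by apply/permP => P; rewrite /= ?count_cat /= ?count_cat /=; lia.
  - by rewrite /= size_cat !size_zip !size_map sb minnn; move: szk => /=; lia.
have hx : h x = q by apply: (hE (x, q)); rewrite mem_head.
have hgx : h (g x) = b by apply: (hE (g x, b)); rewrite !inE eqxx !orbT.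
have hp : h p = g x by apply: (hE (p, g x)); rewrite !inE eqxx !orbT.
have hvs : map h vs = map g vs.
  apply: map_zip; rewrite ?size_map // => z zz; apply: hE.
  by rewrite !inE mem_cat zz !orbT.
have hgvs : map h (map g vs) = bs.
  apply: map_zip; rewrite ?size_map // => z zz; apply: hE.
  by rewrite !inE mem_cat zz !orbT.
exists (g * g ^ h)%g.
  have [sN _ NJ] := GLfin_normal sH.
  have [_ NM _] := (subgroupP _).1 sN.
  by apply: (NM); [|apply: NJ].
exists [:: q, x & vs] => //.
have gJ v w : h v = w -> (g ^ h)%g w = h (g v) by move=> <-; rewrite /= GLK.
have e1 : (g * g ^ h)%g q = a *: b.
  by rewrite GL_mulE gq GLZ (gJ _ _ hx) hgx.
have e2 : (g * g ^ h)%g x = a *: g x.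
  by rewrite GL_mulE (gJ _ _ hp) gp GLZ hp.
have e3 : map (g * g ^ h)%g vs = bs.
  rewrite -hgvs -map_comp; apply/eq_in_map => v vvs.
  by rewrite GL_mulE (gJ v) //; move/eq_in_map: hvs; apply.
have eM : map (g * g ^ h)%g [:: q, x & vs] = [:: a *: b, a *: g x & bs].
  by rewrite -e1 -e2 -e3.
(* Up to the nonzero factor [a], these vectors are the family of [fb] without [map g vs]. *)
rewrite /displaces eM.
apply: (@free_perm _ _ (a *: b :: (a *: g x :: [:: q, x & vs] ++ bs))).
  by apply/permP => P; rewrite /= ?count_cat /=; lia.
apply: free_scale_head => //.
apply: (@free_perm _ _ (a *: g x :: (b :: [:: q, x & vs] ++ bs))).
  by apply/permP => P; rewrite /= ?count_cat /=; lia.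
apply: free_scale_head => //.
apply: (@free_subperm _ _ (map g vs)) fb.
by apply/permP => P; rewrite /= ?count_cat /= ?count_cat /=; lia.
Qed.

(** A nonscalar [g] moves some vector off its line, which settles [n = 1]. Passing from [n] to
    [n + 1] needs [2n < k], whence the bound. *)
Lemma exists_displaces k H g n :
  subgroup H -> linearly_transitive k H -> (0 < n)%N -> (n.*2 <= k.+1)%N ->
  (H `&` GLfin V) g -> (forall a : F, a != 0 -> exists v, g v <> a *: v) ->
  exists2 g', (H `&` GLfin V) g' & exists2 s, size s = n & displaces g' s.
Proof.
move=> sH Hk + + Ng gNs; elim: n => [//|[|n] IH] _ nk.
  exists g => //.
  have [v [v0 gv]] : exists v, ~ span [::] v /\ ~ span [:: v] (g v).
    apply: contrapT => nv; have [|a a0 ga] := @scalar_mod _ _ infV [::] g.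
      by move=> v v0; apply: contrapT => gv; apply: nv; exists v.
    by have [v] := gNs a a0; apply; apply/eqP; rewrite -subr_eq0; apply/eqP/ga.
  exists [:: v] => //; apply: (@free_perm _ _ [:: g v; v]).
    by apply/permP => P /=; lia.
  by apply/free_cons; split=> //; apply/free_cons; split=> //; exact: free_nil.
have [//||g' Ng' [s sz ds]] := IH; first by move: nk; lia.
have := displaces_grow sH Hk _ _ Ng' ds; rewrite sz; exact.
Qed.

Lemma GLfin_transitive k H g n :
  subgroup H -> linearly_transitive k H -> (n.*2 <= k)%N ->
  (H `&` GLfin V) g -> (forall a : F, a != 0 -> exists v, g v <> a *: v) ->
  linearly_transitive n (H `&` GLfin V).
Proof.
move=> sH Hk nk Ng gNs u w fu fw.
have [sN _ NJ] := GLfin_normal sH.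
have [N1 NM _] := (subgroupP _).1 sN.
have [n0|n0] := posnP n.
  by exists 1%g => // i; have := ltn_ord i; rewrite [X in (_ < X)%N]n0.
have [|g' Ng' [s ss ds]] := exists_displaces sH Hk n0 _ Ng gNs; first by lia.
(* Conjugate [g'] by an [h] carrying [s] to [s1] and [map g' s] to [s2]; this prescribes [2n <= k]
   vectors. *)
have step (s1 s2 : seq V) : size s1 = n -> size s2 = n -> free (s1 ++ s2) ->
    exists2 g, (H `&` GLfin V) g & map g s1 = s2.
  move=> z1 z2 f12.
  have [||| h Hh hE] := linearly_transitive_seq (zs := zip s s1 ++ zip (map g' s) s2) Hk.
  - rewrite /unzip1 map_cat -/(unzip1 _) -/(unzip1 _) !unzip1_zip ?size_map ?ss ?z1 ?z2 //.
  - by rewrite /unzip2 map_cat -/(unzip2 _) -/(unzip2 _) !unzip2_zip ?size_map ?ss ?z1 ?z2.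
  - by rewrite size_cat !size_zip size_map ss z1 z2 minnn; lia.
  exists (g' ^ h)%g; first exact: NJ.
  have h1 : map h s = s1.
    by apply: map_zip; rewrite ?ss // => z zz; apply: hE; rewrite mem_cat zz.
  have h2 : map h (map g' s) = s2.
    by apply: map_zip; rewrite ?size_map ?ss // => z zz; apply: hE; rewrite mem_cat zz orbT.
  by rewrite -h1 -h2 -!map_comp; apply/eq_map => v; rewrite /= GLK.
have cu : size (codom u) = n by rewrite size_codom card_ord.
have cw : size (codom w) = n by rewrite size_codom card_ord.
(* The families [u] and [w] may depend on each other, so the move passes through a list [r]
   independent of each. *)
have [r [sr fru frw]] := free_extend n ((free_lin_indep u).2 fu) ((free_lin_indep w).2 fw).
have [|g1 Ng1 e1] := step _ r cu sr.
  by apply: free_perm fru; rewrite perm_catC.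
have [g2 Ng2 e2] := step _ _ sr cw frw.
exists (g1 * g2)%g; first exact: NM.
move=> i; move: e2; rewrite -e1 !codomE -!map_comp => /eq_in_map; apply.
by rewrite -enumT mem_enum.
Qed.

End Transitivity.

(** * Prescribing the variables of a word along a trajectory *)

Section Words.
Local Open Scope ring_scope.
Variables (F : finFieldType) (V : lmodType F) (r : nat).
Implicit Types (s t : seq V) (u v w : V) (g : GL V) (H : set (GL V)).
Implicit Types (h : 'I_r -> GL V) (p : 'I_r -> seq (V * V)).
Hypothesis infV : infinite_set [set: V].

(* A letter together with the constant following it. *)
Local Notation letter := ('I_r * bool * GL V)%type.
Implicit Types (x y : letter) (L : seq letter).

Definition letter_act h v x : V :=
  x.2 ((if x.1.2 then h x.1.1 else (h x.1.1)^-1)%g v).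

Lemma eval_act h L v :
  (\prod_(x <- L) ((if x.1.2 then h x.1.1 else (h x.1.1)^-1) * x.2))%g v =
  foldl (letter_act h) v L.
Proof.
elim: L v => [|x L IH] v; first by rewrite big_nil.
by rewrite big_cons GL_mulE IH.
Qed.

(** A letter of sign [e] reads a pair at [side e] and outputs [side (~~ e)]. *)
Definition side (e : bool) (z : V * V) : V := if e then z.1 else z.2.

Definition mk_pair (e : bool) u w : V * V := if e then (u, w) else (w, u).

Definition add_pair p x u w : 'I_r -> seq (V * V) :=
  fun i => if i == x.1.1 then mk_pair x.1.2 u w :: p i else p i.

(** The value of the next letter at [u] can still be prescribed; after the last letter the
    trajectory must have missed [v0]. *)
Definition ready p L v0 u : Prop :=
  if L is x :: _ then ~ span (map (side x.1.2) (p x.1.1)) u else u <> v0.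

Definition compatible x y : bool :=
  (x.1.1 == y.1.1) && (x.1.2 != y.1.2) ==> (x.2 \notin GLfin V).

Lemma avoid_image s t g : exists w, ~ span s w /\ ~ span t (g w).
Proof.
have fU : finite_set (span s `|` (g^-1)%g @` span t).
  by rewrite finite_setU; split; [|apply: finite_image]; exact: finite_span.
have [w /not_orP[ws wt]] := exists_notin infV fU; exists w; split=> // gw.
by apply: wt; exists (g w) => //; rewrite GLK.
Qed.

Lemma avoid_nonscalar s g : g \notin GLfin V -> exists w, ~ span s w /\ ~ span (w :: s) (g w).
Proof.
move=> /negP gN; apply: contrapT => nw; apply: gN; rewrite inE; apply/GLfinP.
have [|a a0 ga] := @scalar_mod _ _ infV s g.
  by move=> v vs; apply: contrapT => gv; apply: nw; exists v.
by exists a => //; apply: sub_finite_set (finite_span s) => _ [v _ <-].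
Qed.

(** [w] is the value given to the letter [x] at [u]: it must be new on the output side of [x], and
    [x.2 w] new on the side read next. *)
Lemma exists_ready p x L u v0 : path compatible x L ->
  exists w, ~ span (map (side (~~ x.1.2)) (p x.1.1)) w /\
            ready (add_pair p x u w) L v0 (x.2 w).
Proof.
case: L => [_|y L /= /andP[xy _]].
  have [w [w1 w2]] := avoid_image (map (side (~~ x.1.2)) (p x.1.1)) [:: v0] x.2.
  by exists w; split=> // e; apply: w2; rewrite e; apply: mem_span; rewrite mem_head.
have [e1|n1] := eqVneq y.1.1 x.1.1; last first.
  have [w [w1 w2]] := avoid_image (map (side (~~ x.1.2)) (p x.1.1))
                        (map (side y.1.2) (p y.1.1)) x.2.
  by exists w; rewrite /ready /add_pair (negbTE n1).
(* If the signs agree, the side read by [y] has gained [u], known before [w] is chosen. *)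
have [e2|n2] := eqVneq y.1.2 x.1.2.
  have [w [w1 w2]] := avoid_image (map (side (~~ x.1.2)) (p x.1.1))
                        (u :: map (side x.1.2) (p x.1.1)) x.2.
  exists w; split=> //; rewrite /ready /add_pair e1 e2 eqxx map_cons.
  by rewrite {1}/side /mk_pair; case: x.1.2 w2.
(* For opposite signs that side has gained [w] itself, so the constant must move [w] off its line
   modulo the earlier vectors. *)
have e2 : y.1.2 = ~~ x.1.2 by move: n2; case: x.1.2 y.1.2 => -[].
move: xy; rewrite /compatible e1 eqxx eq_sym n2 => /= cN.
have [w [w1 w2]] := avoid_nonscalar (map (side (~~ x.1.2)) (p x.1.1)) cN.
exists w; split=> //; rewrite /add_pair e2 eqxx map_cons.
by rewrite {1}/side /mk_pair; case: x.1.2 w2.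
Qed.

(* The list [p i] prescribes the values of [h i]; it grows by one pair for each letter
   of [L] in the variable [i]. *)
Lemma exists_run k H p L v0 u : linearly_transitive k H ->
  (forall i e, free (map (side e) (p i))) -> sorted compatible L ->
  ready p L v0 u -> (forall i, size (p i) + size L <= k)%N ->
  exists h, [/\ forall i, H (h i), forall i z, z \in p i -> h i z.1 = z.2 &
                foldl (letter_act h) u L <> v0].
Proof.
move=> Hk; elim: L p u => [|x L IH] p u fp sL rL szL.
  have hP i : exists g, H g /\ forall z, z \in p i -> g z.1 = z.2.
    have [] := linearly_transitive_seq infV Hk (fp i true) (fp i false).
      by have := szL i; rewrite addn0.
    by move=> g Hg gE; exists g.
  have [h hE] := choice hP.
  by exists h; split=> // i; case: (hE i).
have [w [ws wr]] := exists_ready p u v0 sL.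
have [|||| h [Hh hE hv0]] := IH (add_pair p x u w) (x.2 w).
- move=> i e; rewrite /add_pair; case: eqP => [->|_]; last exact: fp.
  rewrite map_cons; apply/free_cons; split=> //.
  move: ws rL => /=; rewrite /mk_pair /side.
  by case: x.1.2; case: e.
- exact: path_sorted sL.
- exact: wr.
- move=> i; apply: leq_trans (szL i); rewrite /add_pair /=.
  by case: eqP => /=; lia.
exists h; split=> //.
  by move=> i z zp; apply: hE; rewrite /add_pair; case: eqP => _ //; rewrite in_cons zp orbT.
suff -> : foldl (letter_act h) u (x :: L) = foldl (letter_act h) (x.2 w) L by [].
rewrite [LHS]/=; congr foldl; rewrite /letter_act; congr (x.2 _).
have := hE x.1.1 (mk_pair x.1.2 u w); rewrite /add_pair eqxx mem_head => /(_ erefl).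
by rewrite /mk_pair; case: x.1.2 => /= <- //; rewrite GLK.
Qed.

End Words.

(** * From a mixed identity to a nonscalar element of [GLfin V] *)

Section MixedIdentity.
Local Open Scope ring_scope.
Variables (F : finFieldType) (V : lmodType F).

Lemma scalar_center (H : set (GL V)) (g : GL V) (a : F) :
  H g -> (forall v, g v = a *: v) -> center H g.
Proof.
by move=> Hg ga; split=> // h _; apply: GL_ext => v; rewrite !GL_mulE !ga GLZ.
Qed.

(** Scalars are central, so if the conclusion fails, noncentral constants avoid [GLfin V] and a run
    can end away from its start. Each variable gets at most [l <= k] pairs. *)
Lemma mixed_identity_nonscalar (H : set (GL V)) k l : infinite_set [set: V] ->
  linearly_transitive k H -> has_mixed_identity H l -> (l <= k)%N ->
  exists2 g : GL V, (H `&` GLfin V) g & forall a : F, a != 0 -> exists v, g v <> a *: v.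
Proof.
move=> infV Hk [l0 [r [_ [w [Hw rw w1]]]]] lk.
apply: contrapT => nex.
have cN j : ~ center H (cst w j) -> cst w j \notin GLfin V.
  move=> nc; apply/negP; rewrite inE => fc; apply: nc.
  apply: contrapT => nc; apply: nex; exists (cst w j) => // a _.
  apply: contrapT => nv; apply: nc; apply: (scalar_center (a := a) (Hw j)) => v.
  by apply: contrapT => nga; apply: nv; exists v.
pose f (j : 'I_l) := (var w j, sgn w j, cst w (lift ord0 j)).
pose j0 := Ordinal l0.
have [e [eE se ne]] : exists e, [/\ e = index_enum 'I_l, size e = l &
    forall j, (j < l)%N -> nth j0 e j = j :> nat].
  exists (enum 'I_l); split=> [||j].
  - by rewrite [index_enum _]unlock enumT.
  - exact: size_enum_ord.
  - exact: nth_enum_ord.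
pose L := map f e.
have sL : size L = l by rewrite size_map.
have [v0 v0N] := exists_notin infV (finite_set1 (0 : V)).
have [||||h [Hh _]] :=
    @exists_run _ _ r infV k H (fun=> [::]) L v0 (cst w ord0 v0) Hk.
- by move=> *; exact: free_nil.
- apply/(sortedP (f j0)) => j; rewrite sL => jl.
  have jl' : (j < l)%N := ltnW jl.
  rewrite !(nth_map j0) ?se //.
  have := rw (nth j0 e j) (nth j0 e j.+1).
  rewrite !ne // => /(_ erefl); rewrite /compatible /f /=.
  by case: ifP => // _ /cN.
(* Nothing is prescribed yet, so the image of [v0] under the leading constant only has to be
   nonzero. *)
- move: sL; case: L => [/esym l00|x L' _]; first by exfalso; have := l0; rewrite l00.
  by move=> /= c0; apply: v0N; apply: (@GL_inj _ _ (cst w ord0)); rewrite c0 linear0.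
- by move=> i; rewrite sL.
apply; rewrite -eval_act big_map eE.
have := congr1 (fun g : GL V => g v0) (w1 h Hh).
by rewrite /eval GL_mulE.
Qed.

Lemma countable_dim_infinite : countably_infinite_dim V -> infinite_set [set: V].
Proof.
move=> [b [ib _]] fV; apply: infinite_nat.
apply: (@sub_finite_set _ _ (b @^-1` [set: V])) => //.
by apply: finite_preimage => // i j _ _; exact: lin_indep_inj.
Qed.

End MixedIdentity.

Theorem theorem6 (F : finFieldType) (V : lmodType F) (k l : nat)
    (H : set (GL V)) :
  countably_infinite_dim V ->
  (1 <= k)%N ->
  subgroup H ->
  linearly_transitive k H ->
  has_mixed_identity H l ->
  [/\ locally_finite (H `&` GLfin V),
      linearly_transitive (uphalf k).-1 (H `&` GLfin V) &
      normal_subgroup (H `&` GLfin V) H]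
  \/ (k <= 2 * l)%N.
Proof.
move=> /countable_dim_infinite infV _ sH Hk Hl.
have [kl|lk] := leqP k (2 * l); [by right|left].
have [g Ng gN] : exists2 g : GL V, (H `&` GLfin V) g &
    forall a : F, a != 0%R -> exists v, g v <> (a *: v)%R.
  by apply: mixed_identity_nonscalar Hl _; [|exact: Hk|lia].
split; [by apply: GLfin_locally_finite => h []| |exact: GLfin_normal].
apply: (GLfin_transitive infV sH Hk _ Ng gN).
(* [(uphalf k).-1] is [ceil(k/2) - 1], whose double is at most [k]. *)
by have := odd_double_half k.+1; rewrite -uphalfE; lia.
Qed.
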